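(* For $n\geq 1$ and $m\geq 2$, the maximum forcing number of $T(2n+1,2m)$ is $F(T(2n+1,2m))=(n+1)m$.
   Context: $T(2n+1,2m)$ is the graph with vertices $(u_i,v_j)$, $i\in\mathbb{Z}_{2m}$, $j\in\mathbb{Z}_{2n+1}$, where $(u_i,v_j)$ is adjacent to $(u_{i+1},v_j)$ and to $(u_i,v_{j+1})$ (the grid graph of the quadriculated torus). For a perfect matching $M$ of a graph $G$, a subset $S\subseteq M$ is a forcing set of $M$ if no other perfect matching of $G$ contains $S$; the forcing number $f(G,M)$ is the minimum size of a forcing set of $M$. The maximum forcing number $F(G)$ is the maximum of $f(G,M)$ over all perfect matchings $M$ of $G$. *)

(* Defs.v *)
From mathcomp Require Import all_boot.
Set Implicit Arguments. Unset Strict Implicit. Unset Printing Implicit Defensive.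

Section Matchings.
Variables (V : finType) (adj : rel V).

Definition edges : {set {set V}} :=
  [set e : {set V} | [exists x : V, exists y : V, adj x y && (e == [set x; y])]].

Definition perfect_matching (M : {set {set V}}) : bool :=
  (M \subset edges) && [forall v : V, #|[set e in M | v \in e]| == 1].

Definition forcing_set (M S : {set {set V}}) : bool :=
  (S \subset M) &&
  [forall M' : {set {set V}}, (perfect_matching M' && (S \subset M')) ==> (M' == M)].

(* forcing number f(G,M): minimum size of a forcing set of M
   (M itself is always a forcing set, so #|M| is a valid default) *)
Definition forcing_number (M : {set {set V}}) : nat :=
  \big[minn/#|M|]_(S in powerset M | forcing_set M S) #|S|.

Definition max_forcing_number : nat :=
  \max_(M : {set {set V}} | perfect_matching M) forcing_number M.
End Matchings.

Definition torus_vertex (n m : nat) : finType := ('I_(2 * m) * 'I_(2 * n + 1))%type.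

Definition succ_mod (k a b : nat) : bool := (a.+1 %% k == b) || (b.+1 %% k == a).

Definition torus_adj (n m : nat) : rel (torus_vertex n m) :=
  fun x y =>
    ((x.2 == y.2) && succ_mod (2 * m) x.1 y.1) ||
    ((x.1 == y.1) && succ_mod (2 * n + 1) x.2 y.2).

(* Main.v *)
(* Upper bound: let X be an independent set of nm vertices lying in the even
   columns, n in each, arranged so that two consecutive even columns never use a
   common row, except possibly the two columns next to the last one.  If T is
   the set of edges of M that meet X, then |M \ T| = (n+1)m, and M \ T is
   forcing: an alternating cycle on the vertices of T runs between X and its
   partners, passing straight through the partners, so it never leaves its
   column or the pair of columns next to the last one.  A single column carries
   no such cycle, and a cycle on the pair would enclose an odd number of vertices
   of the last column, which M would have to match among themselves.

   Lower bound: for the matching by the edges (u_2k,v_j)(u_2k+1,v_j), consecutive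
   edges of the ladder k lie on an alternating square, so a forcing set contains
   a vertex cover of the odd cycle C_2n+1 for each of the m ladders. *)
Require Import Defs.
From mathcomp Require Import all_boot.
From mathcomp Require Import zify.
Set Implicit Arguments. Unset Strict Implicit. Unset Printing Implicit Defensive.

Lemma bigminn_leq (I : eqType) (r : seq I) (P : pred I) (F : I -> nat) d j :
  j \in r -> P j -> \big[minn/d]_(i <- r | P i) F i <= F j.
Proof.
move=> jr Pj; elim: r jr => // i r IHr; rewrite inE big_cons.
case/orP=> [/eqP <-|/IHr le_j]; first by rewrite Pj geq_minl.
by case: ifP => // _; apply: leq_trans le_j; rewrite geq_minr.
Qed.

Lemma set2_injr (T : finType) (x y z : T) :
  y != x -> [set x; y] = [set x; z] -> y = z.
Proof.
move=> yx /setP/(_ y); rewrite !inE eqxx orbT (negbTE yx) /=.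
by move/esym/eqP.
Qed.

Lemma vertex_cover_odd_cycle n (J : {set 'I_(2 * n + 1)}) :
  (forall j, (j \in J) || (ordS j \in J)) -> n + 1 <= #|J|.
Proof.
move=> cov.
have cardJ : #|J| = \sum_(j : 'I_(2 * n + 1)) (j \in J).
  by rewrite -sum1_card big_mkcond.
have cardJS : #|J| = \sum_(j : 'I_(2 * n + 1)) (ordS j \in J).
  by rewrite cardJ (reindex_inj (@ordS_inj _)).
have: 2 * n + 1 <= #|J| + #|J|.
  rewrite {1}cardJ cardJS -big_split /= -[X in X <= _]card_ord -sum1_card.
  by apply: leq_sum => j _; have := cov j; do 2!case: (_ \in J).
lia.
Qed.

Section InvolutionMatching.
Variables (V : finType) (adj : rel V).
Hypotheses (adjC : symmetric adj) (adj_irr : irreflexive adj).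

Definition matching_of (mu : V -> V) : {set {set V}} :=
  [set [set v; mu v] | v : V].

Let adj_neq (mu : V -> V) : (forall v, adj v (mu v)) -> forall v, mu v != v.
Proof. by move=> amu v; apply: contraTneq (amu v) => ->; rewrite adj_irr. Qed.

Lemma matching_ofP mu : involutive mu -> forall v e,
  e \in matching_of mu -> v \in e -> e = [set v; mu v].
Proof.
move=> muK v e /imsetP[w _ ->]; rewrite !inE => /orP[]/eqP-> //.
by rewrite muK setUC.
Qed.

Lemma perfect_matching_of mu :
  involutive mu -> (forall v, adj v (mu v)) ->
  perfect_matching adj (matching_of mu).
Proof.
move=> muK amu; apply/andP; split.
  apply/subsetP=> e /imsetP[v _ ->]; rewrite inE.
  by apply/existsP; exists v; apply/existsP; exists (mu v); rewrite amu /=.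
apply/forallP=> v; apply/eqP/eqP/cards1P; exists [set v; mu v].
apply/setP=> e; rewrite !inE; apply/andP/eqP => [[eM ve]|->].
  exact: (matching_ofP muK).
by rewrite !inE eqxx; split=> //; apply/imsetP; exists v.
Qed.

Lemma perfect_matchingP M : perfect_matching adj M ->
  exists mu : V -> V,
    [/\ involutive mu, forall v, adj v (mu v) & M = matching_of mu].
Proof.
case/andP=> /subsetP sME /forallP Muniq.
have edgeM v : exists w, adj v w && ([set v; w] \in M).
  have /cards1P[e /setP De] := Muniq v.
  have := De e; rewrite !inE eqxx => /andP[eM ve].
  have := sME e eM; rewrite inE => /existsP[x /existsP[y /andP[axy /eqP De']]].
  move: ve; rewrite De' !inE => /orP[]/eqP ->.
    by exists y; rewrite axy -De'.
  by exists x; rewrite adjC axy setUC -De'.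
have [mu Hmu] := fin_all_exists edgeM.
have amu v : adj v (mu v) by case/andP: (Hmu v).
have muM v : [set v; mu v] \in M by case/andP: (Hmu v).
have Me v e : e \in M -> v \in e -> e = [set v; mu v].
  move=> eM ve; have /cards1P[f /setP Df] := Muniq v.
  have := Df e; rewrite !inE eM ve => /esym/eqP ->.
  by have := Df [set v; mu v]; rewrite !inE muM eqxx => /esym/eqP ->.
exists mu; split=> //.
  move=> v; apply/esym; apply: (@set2_injr _ (mu v)); first by rewrite eq_sym adj_neq.
  by rewrite setUC; apply: Me; rewrite ?muM // !inE eqxx orbT.
apply/setP=> e; apply/idP/imsetP=> [eM|[v _ ->] //].
have := sME e eM; rewrite inE => /existsP[x /existsP[y /andP[_ /eqP De]]].
by exists x => //; apply: Me; rewrite // De !inE eqxx.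
Qed.

Lemma double_card_perfect_matching M : perfect_matching adj M -> #|M| * 2 = #|V|.
Proof.
move=> pM; case/andP: (pM) => /subsetP sME /forallP Muniq.
have -> : #|V| = \sum_(v : V) \sum_(e in M) (v \in e).
  rewrite -sum1_card; apply: eq_bigr => v _.
  rewrite -(eqP (Muniq v)) -sum1_card big_mkcond [in RHS]big_mkcond /=.
  by apply: eq_bigr => e _; rewrite inE; case: (e \in M) => //=; case: (v \in e).
rewrite exchange_big /= -sum_nat_const; apply: eq_bigr => e eM.
rewrite -big_mkcond sum1_card.
have := sME e eM; rewrite inE => /existsP[x /existsP[y /andP[axy /eqP De]]].
rewrite De cards2; case: eqP axy => // ->; by rewrite adj_irr.
Qed.

Lemma forcing_number_leq M S : forcing_set adj M S -> forcing_number adj M <= #|S|.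
Proof.
move=> fS; apply: bigminn_leq; rewrite ?mem_index_enum // fS andbT powersetE.
by case/andP: fS.
Qed.

Lemma forcing_number_geq M k : perfect_matching adj M ->
  (forall S, forcing_set adj M S -> k <= #|S|) -> k <= forcing_number adj M.
Proof.
move=> pM lek; apply: (big_ind (fun l => k <= l)).
- apply: lek; rewrite /forcing_set subxx /=; apply/forallP=> M'.
  apply/implyP=> /andP[pM' sMM']; rewrite eq_sym eqEcard sMM' /=.
  by rewrite -(leq_pmul2r (isT : 0 < 2)) !double_card_perfect_matching.
- by move=> x y; rewrite leq_min => -> ->.
- by move=> S /andP[_ /lek].
Qed.

Section AlternatingCycles.
Variables (mu mu' : V -> V) (X : {set V}).
Hypotheses (muK : involutive mu) (mu'K : involutive mu').
Hypotheses (amu : forall v, adj v (mu v)) (amu' : forall v, adj v (mu' v)).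
Hypothesis indepX : {in X &, forall x y, ~~ adj x y}.
Hypothesis agree : forall v, v \notin X -> mu v \notin X -> mu' v = mu v.

Definition alternating (x : V) := (x \in X) && (mu x != mu' x).
(* The edges of the [mu]/[mu']-alternating cycles, directed from [X]. *)
Definition linked (x y : V) := alternating x && ((y == mu x) || (y == mu' x)).

Lemma linked_self x : alternating x -> linked x (mu x).
Proof. by move=> ax; rewrite /linked ax eqxx. Qed.

Lemma linked_alternating x y : linked x y -> alternating x.
Proof. by case/andP. Qed.

Lemma mu_mu'_in x : x \in X -> mu (mu' x) \in X.
Proof.
move=> xX; apply/negPn/negP=> muwX.
have wX : mu' x \notin X by apply/negP=> wX; have := indepX xX wX; rewrite amu'.
by have := agree wX muwX; rewrite mu'K => Dx; rewrite -Dx xX in muwX.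
Qed.

(* [mu \o mu'] maps [X] injectively into itself, hence onto itself. *)
Lemma mu'_mu_in x : x \in X -> mu' (mu x) \in X.
Proof.
move=> xX; have : [set mu (mu' z) | z in X] = X.
  apply/eqP; rewrite eqEcard; apply/andP; split.
    by apply/subsetP=> _ /imsetP[z zX ->]; apply: mu_mu'_in.
  by rewrite card_imset //; apply: inj_comp; apply: inv_inj.
move/setP/(_ x); rewrite xX => /imsetP[z zX ->].
by rewrite muK mu'K.
Qed.

Lemma linked_mu x y : linked x y -> mu y \in X.
Proof.
by case/andP=> /andP[xX _] /orP[]/eqP->; rewrite ?muK // mu_mu'_in.
Qed.

Lemma linked_other x y : linked x y -> exists2 w, linked x w & w != y.
Proof.
rewrite /linked => /andP[ax]; rewrite ax /= => H.
have neq : mu x != mu' x by case/andP: ax.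
case/orP: H => /eqP->; [exists (mu' x) | exists (mu x)]; rewrite ?eqxx ?orbT //.
by rewrite eq_sym.
Qed.

Lemma linked_adj x y : linked x y -> adj x y.
Proof. by case/andP=> _ /orP[]/eqP->. Qed.

Lemma linked_next x y : linked x y -> exists2 x', linked x' y & x' != x.
Proof.
case/andP=> /andP[xX neq] /orP[]/eqP->.
  have neq' : mu' (mu x) != x.
    by apply: contraNneq neq => {2}<-; rewrite mu'K.
  exists (mu' (mu x)) => //; rewrite /linked /alternating mu'_mu_in // mu'K eqxx orbT andbT.
  by apply: contraNneq neq' => E; rewrite -[mu' _]muK E muK.
have neq' : mu (mu' x) != x.
  by apply: contraNneq neq => {1}<-; rewrite muK.
exists (mu (mu' x)) => //; rewrite /linked /alternating mu_mu'_in // muK eqxx andbT.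
by apply: contraNneq neq' => E; rewrite -[mu _]mu'K -E mu'K.
Qed.

End AlternatingCycles.
End InvolutionMatching.

Lemma succ_modE k a b : a < k -> b < k ->
  succ_mod k a b = [|| b == a.+1, a == b.+1, (a.+1 == k) && (b == 0)
                     | (b.+1 == k) && (a == 0)].
Proof.
move=> ak bk; rewrite /succ_mod.
have modS c : c < k -> c.+1 %% k = if c.+1 == k then 0 else c.+1.
  by move=> ck; case: eqP => [->|?]; rewrite ?modnn // modn_small //; lia.
rewrite !modS //; case: (a.+1 =P k) => ?; case: (b.+1 =P k) => ? /=; lia.
Qed.

Section Torus.
Variables n m : nat.
Hypotheses (hn : 1 <= n) (hm : 2 <= m).
Notation V := (torus_vertex n m).
Notation adj := (@torus_adj n m).

Lemma vertex_neq (u v : V) :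
  u != v -> ~ ((u.1 : nat) = v.1 /\ (u.2 : nat) = v.2).
Proof.
case: u v => [u1 u2] [v1 v2] /eqP neq /= [E1 E2].
by apply: neq; congr (_, _); apply: val_inj.
Qed.

Lemma vertex_bounds (v : V) : v.1 < 2 * m /\ v.2 < 2 * n + 1.
Proof. by split; apply: ltn_ord. Qed.

Lemma torus_adjP (x y : V) : reflect
  (((x.2 : nat) = y.2 /\
     ((y.1 : nat) = x.1.+1 \/ (x.1 : nat) = y.1.+1 \/
      (x.1 : nat) = (2 * m).-1 /\ (y.1 : nat) = 0 \/
      (y.1 : nat) = (2 * m).-1 /\ (x.1 : nat) = 0)) \/
   ((x.1 : nat) = y.1 /\
     ((y.2 : nat) = x.2.+1 \/ (x.2 : nat) = y.2.+1 \/
      (x.2 : nat) = 2 * n /\ (y.2 : nat) = 0 \/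
      (y.2 : nat) = 2 * n /\ (x.2 : nat) = 0))) (adj x y).
Proof.
case: x y => [x1 x2] [y1 y2]; rewrite /torus_adj /= !succ_modE // -!val_eqE /=.
have := ltn_ord x1; have := ltn_ord y1; have := ltn_ord x2; have := ltn_ord y2.
move: (x1 : nat) (x2 : nat) (y1 : nat) (y2 : nat) => {x1 x2 y1 y2} a b c d ? ? ? ?.
by apply: (iffP idP); lia.
Qed.

Lemma torus_adjC : symmetric adj.
Proof.
by move=> x y; rewrite /torus_adj /succ_mod eq_sym (eq_sym x.1) orbC
  [in RHS]orbC; congr (_ && _ || _ && _); rewrite orbC.
Qed.

Lemma torus_adj_irr : irreflexive adj.
Proof. by move=> x; apply/torus_adjP; have := ltn_ord x.1; have := ltn_ord x.2; lia. Qed.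

(* Every second vertex of every even column, with the parity of the rows
   alternating from one even column to the next; row 0 is left out, so that the
   two parities give the same number n of vertices. *)
Definition staggered : {set V} :=
  [set x : V | ((x.1 %% 4 == 0) && odd x.2)
            || [&& x.1 %% 4 == 2, ~~ odd x.2 & 0 < x.2]].

Lemma staggeredP (x : V) :
  x \in staggered -> x.1 %% 4 + 2 * (x.2 %% 2) = 2 /\ 0 < x.2.
Proof.
rewrite inE !modn2 => /orP[/andP[/eqP-> ox]|/and3P[/eqP-> /negbTE-> ->]] //.
by rewrite ox odd_gt0.
Qed.

Lemma odd_column_notin (v : V) : odd v.1 -> v \notin staggered.
Proof. by move=> ov; apply/negP=> /staggeredP[]; lia. Qed.

Lemma staggered_indep : {in staggered &, forall x y, ~~ adj x y}.
Proof.
move=> x y /staggeredP Xx /staggeredP Xy; apply/negP=> /torus_adjP.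
have := ltn_ord x.1; have := ltn_ord x.2; have := ltn_ord y.1; have := ltn_ord y.2.
lia.
Qed.

Lemma card_staggered : n * m <= #|staggered|.
Proof.
have lt1 (k : 'I_m) : 2 * k < 2 * m by have := ltn_ord k; lia.
have lt2 (k : 'I_m) (l : 'I_n) : 2 * l + 1 + k %% 2 < 2 * n + 1.
  by have := ltn_ord l; lia.
pose f (p : 'I_m * 'I_n) : V := (Ordinal (lt1 p.1), Ordinal (lt2 p.1 p.2)).
have injf : injective f.
  move=> [k l] [k' l'] [E1 E2]; have Ek : k = k' by apply: val_inj => /=; lia.
  by rewrite Ek in E2 *; congr (_, _); apply: val_inj => /=; lia.
have -> : n * m = #|[set f p | p in [set: 'I_m * 'I_n]]|.
  by rewrite card_imset // cardsT card_prod !card_ord mulnC.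
apply/subset_leq_card/subsetP=> _ /imsetP[[k l] _ ->]; rewrite inE /=; lia.
Qed.

Lemma staggered_neighbor (x y : V) : x \in staggered -> adj x y ->
  ((x.1 : nat) = y.1 /\
    ((y.2 : nat) = x.2.+1 \/ (x.2 : nat) = y.2.+1 \/
     (x.2 : nat) = 2 * n /\ (y.2 : nat) = 0)) \/
  ((x.2 : nat) = y.2 /\ y.1 %% 2 = 1 /\
    ((x.1 : nat) = y.1.+1 \/ (y.1 : nat) = x.1.+1 \/
     (y.1 : nat) = (2 * m).-1 /\ (x.1 : nat) = 0)).
Proof.
move=> /staggeredP[Xx Px] /torus_adjP.
have := ltn_ord x.1; have := ltn_ord y.1.
move: (x.1 : nat) (x.2 : nat) (y.1 : nat) (y.2 : nat) Xx Px => a b c d Xx Px ? ?.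
by case=> -[E [?|[?|[?|?]]]]; [right|right|right|right|left|left|left|left];
  split=> //; lia.
Qed.

(* The second alternative occurs only for odd m, when the even columns 0 and
   2m-2, on both sides of the last column, use rows of the same parity. *)
Lemma staggered_common_neighbor (x x' y : V) :
  x \in staggered -> x' \in staggered -> x' != x -> adj x y -> adj x' y ->
  ((x.1 : nat) = y.1 /\ (x'.1 : nat) = y.1 /\
    ((y.2 : nat) = x.2.+1 /\ (x'.2 : nat) = y.2.+1 \/
     (y.2 : nat) = x'.2.+1 /\ (x.2 : nat) = y.2.+1)) \/
  ((y.1 : nat) = (2 * m).-1 /\ (x.2 : nat) = y.2 /\ (x'.2 : nat) = y.2 /\
    ((x.1 : nat) = 0 /\ (x'.1 : nat) = (2 * m).-2 \/
     (x'.1 : nat) = 0 /\ (x.1 : nat) = (2 * m).-2)).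
Proof.
move=> Xx Xx' neq axy ax'y.
have {neq} := vertex_neq neq.
have := staggered_neighbor Xx axy; have := staggered_neighbor Xx' ax'y.
have [{}Xx _] := staggeredP Xx; have [{}Xx' _] := staggeredP Xx'.
have := ltn_ord x.1; have := ltn_ord x'.1.
move: (x.1 : nat) (x.2 : nat) (x'.1 : nat) (x'.2 : nat) (y.1 : nat) (y.2 : nat)
  Xx Xx' => a b c d e f Xx Xx' ? ?.
case=> -[H K]; case=> -[H' K'] neq; last 1 first.
- right; case: K => ? K; case: K' => ? K'.
  by case: K => [?|[?|?]]; case: K' => [?|[?|?]]; lia.
- left; case: K => [?|[?|?]]; case: K' => [?|[?|?]]; lia.
- exfalso; lia.
- exfalso; lia.
Qed.

Section NoAlternatingCycle.
Variables mu mu' : V -> V.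
Hypotheses (muK : involutive mu) (mu'K : involutive mu').
Hypotheses (amu : forall v, adj v (mu v)) (amu' : forall v, adj v (mu' v)).
Hypothesis agree :
  forall v, v \notin staggered -> mu v \notin staggered -> mu' v = mu v.

Notation linked := (linked mu mu' staggered).

Lemma staggered_link (x y : V) : linked x y -> exists2 x' : V, linked x' y &
  ((x.1 : nat) = y.1 /\ (x'.1 : nat) = y.1 /\
    ((y.2 : nat) = x.2.+1 /\ (x'.2 : nat) = y.2.+1 \/
     (y.2 : nat) = x'.2.+1 /\ (x.2 : nat) = y.2.+1)) \/
  ((y.1 : nat) = (2 * m).-1 /\ (x.2 : nat) = y.2 /\ (x'.2 : nat) = y.2 /\
    ((x.1 : nat) = 0 /\ (x'.1 : nat) = (2 * m).-2 \/
     (x'.1 : nat) = 0 /\ (x.1 : nat) = (2 * m).-2)).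
Proof.
move=> lxy; have [x' lx'y neq] :=
  linked_next muK mu'K amu' staggered_indep agree lxy.
exists x' => //; apply: staggered_common_neighbor neq _ _.
- by case/andP: lxy => /andP[].
- by case/andP: lx'y => /andP[].
- exact: linked_adj amu amu' _ _ lxy.
- exact: linked_adj amu amu' _ _ lx'y.
Qed.

(* The two columns adjacent to the last one cannot close up above row [z.2]:
   the vertices of the last column enclosed between them would be matched
   vertically in pairs, but there is an odd number of them.  Following the pairs
   upwards, the ladder continues forever. *)
Lemma no_ladder (x1 x2 y1 y2 z : V) :
    linked x1 y1 -> linked x2 y2 ->
    (x1.1 : nat) = 0 -> (y1.1 : nat) = 0 ->
    (x2.1 : nat) = (2 * m).-2 -> (y2.1 : nat) = (2 * m).-2 ->
    (z.1 : nat) = (2 * m).-1 ->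
    (x1.2 : nat) = z.2 -> (x2.2 : nat) = z.2 ->
    (y1.2 : nat) = z.2.+1 -> (y2.2 : nat) = z.2.+1 ->
    ((mu z).2 : nat) <> z.2.+1 ->
  False.
Proof.
have [k] := ubnP (2 * n - z.2).
elim: k x1 x2 y1 y2 z => // k IHk x1 x2 y1 y2 z ltk l1 l2 Dx1 Dy1 Dx2 Dy2 Dz
  Rx1 Rx2 Ry1 Ry2 Nz.
have muX x y : linked x y -> mu y \in staggered.
  exact: linked_mu muK mu'K amu' staggered_indep agree x y.
have [x1' l1' H1] := staggered_link l1; have [x2' l2' H2] := staggered_link l2.
have [w1 lw1 neq1] := linked_other l1'; have [w2 lw2 neq2] := linked_other l2'.
have [z' [Dz' Rz']] : exists z' : V,
    (z'.1 : nat) = (2 * m).-1 /\ (z'.2 : nat) = z.2.+1.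
  by exists (z.1, y1.2).
have z'X : z' \notin staggered.
  by apply: odd_column_notin; rewrite Dz'; clear -hm; lia.
have Nmu (v : V) : mu v \in staggered -> mu z' != v.
  by move=> vX; apply: contraNneq z'X => Dv; rewrite -Dv muK in vX.
have Nz1 := vertex_neq (Nmu _ (muX _ _ l1)).
have Nz2 := vertex_neq (Nmu _ (muX _ _ l2)).
have Nzz : mu z' != z.
  apply/eqP=> Ez; apply: Nz; by have -> : mu z = z' by rewrite -Ez muK.
have {}Nzz := vertex_neq Nzz.
have [Dx1' Rx1'] : (x1'.1 : nat) = 0 /\ (x1'.2 : nat) = z.2.+2.
  by clear - H1 Dx1 Dy1 Rx1 Ry1 hm; lia.
have [Dx2' Rx2'] : (x2'.1 : nat) = (2 * m).-2 /\ (x2'.2 : nat) = z.2.+2.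
  by clear - H2 Dx2 Dy2 Rx2 Ry2 hm; lia.
have /torus_adjP az' := amu z'.
have [_ bx] := vertex_bounds x1'; have [bz _] := vertex_bounds (mu z').
have [Dz1 Dz2] : ((mu z').1 : nat) = z.1 /\ ((mu z').2 : nat) = z.2.+2.
  rewrite Dy1 Dy2 Ry1 Ry2 Dz Dz' Rz' in az' Nz1 Nz2 Nzz *; rewrite Rx1' in bx.
  by clear - az' bz bx Nz1 Nz2 Nzz hm; case: az' => -[? [?|[?|[?|?]]]]; lia.
have Nw (w x : V) : linked x w ->
    ~ ((w.1 : nat) = (mu z').1 /\ (w.2 : nat) = (mu z').2).
  move=> lw; apply: vertex_neq; apply: contraNneq z'X => Dw.
  by have := muX _ _ lw; rewrite Dw muK.
have Nw1 := Nw _ _ lw1; have Nw2 := Nw _ _ lw2.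
have [? _ Hw1] := staggered_link lw1; have [? _ Hw2] := staggered_link lw2.
have {}neq1 := vertex_neq neq1; have {}neq2 := vertex_neq neq2.
rewrite Dz1 Dz2 Dz in Nw1 Nw2.
have [Dw1 Rw1] : (w1.1 : nat) = 0 /\ (w1.2 : nat) = z.2.+3.
  by clear - Hw1 Nw1 neq1 Dx1' Rx1' Dy1 Ry1 hm; lia.
have [Dw2 Rw2] : (w2.1 : nat) = (2 * m).-2 /\ (w2.2 : nat) = z.2.+3.
  by clear - Hw2 Nw2 neq2 Dx2' Rx2' Dy2 Ry2 hm; lia.
apply: (IHk x1' x2' w1 w2 (mu z') _ lw1 lw2); rewrite ?muK ?Dz1 ?Dz2 ?Rz' //.
  by clear - ltk bx Rx1'; lia.
by clear; lia.
Qed.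

Lemma staggered_matching_eq x : mu x = mu' x.
Proof.
have no_alt v : ~~ alternating mu mu' staggered v.
  apply/negP=> av0.
  (* In the lowest row there is no link downwards, so one link goes up and the
     other one sideways; sideways links exist only through the last column. *)
  case: (arg_minnP (fun v : V => v.2 : nat) av0) => {av0}v av minv.
  have minl (u w : V) : linked u w -> v.2 <= u.2 by move/linked_alternating/minv.
  have bottom (u : V) : linked u (mu u) -> (u.2 : nat) = v.2 -> exists y z : V,
     [/\ linked u y, linked u z, (y.1 : nat) = u.1 /\ (y.2 : nat) = u.2.+1 &
       (z.1 : nat) = (2 * m).-1 /\ (z.2 : nat) = u.2].
    move=> lu Ru; have [w lw neq] := linked_other lu.
    have [u1 lu1 H1] := staggered_link lu; have [u2 lu2 H2] := staggered_link lw.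
    have := minl _ _ lu1; have := minl _ _ lu2; have {}neq := vertex_neq neq.
    move=> ? ?.
    have [?|?] : (w.2 : nat) = u.2 \/ (w.2 : nat) = u.2.+1 by lia.
      by exists (mu u), w; split=> //; lia.
    by exists w, (mu u); split=> //; lia.
  have lv := linked_self av.
  have [y [z [ly lz [Dy Ry] [Dz Rz]]]] := bottom v lv erefl.
  have [v' lz' H] := staggered_link lz.
  have [? ?] := vertex_bounds v; have [? ?] := vertex_bounds z.
  have Rv' : (v'.2 : nat) = v.2 by lia.
  have [y' [? [ly' _ [Dy' Ry'] _]]] :=
    bottom v' (linked_self (linked_alternating lz')) Rv'.
  have muzX : mu z \in staggered.
    by have := linked_mu muK mu'K amu' staggered_indep agree lz.
  have Nz : ((mu z).2 : nat) <> z.2.+1.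
    move=> E; have /torus_adjP := amu z; have := staggeredP muzX.
    by clear - Dz E hm; lia.
  have [[D D']|[D' D]] : (v.1 : nat) = 0 /\ (v'.1 : nat) = (2 * m).-2 \/
     (v'.1 : nat) = 0 /\ (v.1 : nat) = (2 * m).-2.
    by clear - H Dz Rz hm; lia.
    by apply: (no_ladder ly ly' _ _ _ _ Dz) => //;
      clear - Dy Ry Rz Dy' Ry' Rv' D D'; lia.
  by apply: (no_ladder ly' ly _ _ _ _ Dz) => //;
    clear - Dy Ry Rz Dy' Ry' Rv' D D'; lia.
have eqX v : v \in staggered -> mu v = mu' v.
  by move=> vX; have := no_alt v; rewrite /alternating vX negbK => /eqP.
have [/eqX //|xX] := boolP (x \in staggered).
have [/eqX|muxX] := boolP (mu x \in staggered); last by rewrite agree.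
by rewrite muK => {2}->; rewrite mu'K.
Qed.

End NoAlternatingCycle.

Lemma forcing_number_torus_leq M :
  perfect_matching adj M -> forcing_number adj M <= (n + 1) * m.
Proof.
move=> pM.
have [mu [muK amu DM]] := perfect_matchingP torus_adjC torus_adj_irr pM.
pose T := [set e in M | [exists x in e, x \in staggered]].
have sTM : T \subset M by apply/subsetP=> e; rewrite inE => /andP[].
have cardT : n * m <= #|T|.
  apply: leq_trans card_staggered _.
  rewrite -(card_in_imset (f := fun v => [set v; mu v])); last first.
    move=> x y xX yX /setP/(_ x); rewrite !inE eqxx => /esym/orP[/eqP//|/eqP Dx].
    by have := staggered_indep yX xX; rewrite Dx amu.
  apply/subset_leq_card/subsetP=> _ /imsetP[v vX ->].
  rewrite inE DM; apply/andP; split; first by apply/imsetP; exists v.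
  by apply/existsP; exists v; rewrite set21 vX.
have cardM : #|M| = m * (2 * n + 1).
  have := double_card_perfect_matching torus_adj_irr pM.
  rewrite card_prod !card_ord; lia.
have leS : #|M :\: T| <= (n + 1) * m.
  by rewrite cardsDS // cardM; nia.
apply: leq_trans (forcing_number_leq _) leS.
rewrite /forcing_set subsetDl /=; apply/forallP=> M'; apply/implyP=> /andP[pM' sSM'].
have [mu' [mu'K amu' DM']] := perfect_matchingP torus_adjC torus_adj_irr pM'.
suff E : mu =1 mu' by rewrite DM DM'; apply/eqP/eq_imset => v; rewrite E.
apply: staggered_matching_eq => // v vX muvX.
have eM : [set v; mu v] \in M by rewrite DM; apply/imsetP; exists v.
have : [set v; mu v] \in M'.
  apply: (subsetP sSM'); rewrite in_setD in_set eM andbT /=.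
  by apply/existsP=> -[w]; rewrite in_set2 => /andP[/orP[]/eqP->]; apply/negP.
rewrite DM' => eM'; have E := matching_ofP mu'K eM' (set21 v _).
apply/esym; apply: set2_injr E.
by apply: contraTneq (amu v) => ->; rewrite torus_adj_irr.
Qed.

Definition flip (i : 'I_(2 * m)) : 'I_(2 * m) :=
  insubd i (if odd i then i.-1 else i.+1).

Lemma val_flip i : flip i = (if odd i then i.-1 else i.+1) :> nat.
Proof.
rewrite val_insubd ifT //=.
by have := ltn_ord i; case: (boolP (odd i)) => oi; lia.
Qed.

Lemma flipK : involutive flip.
Proof.
move=> i; apply: val_inj; rewrite /= !val_flip.
by case: (boolP (odd i)) => oi; case: ifP => oi'; lia.
Qed.

Lemma flip_half i : (flip i)./2 = i./2.
Proof. by rewrite val_flip; case: (boolP (odd i)) => oi; lia. Qed.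

Definition horizontal (v : V) : V := (flip v.1, v.2).

Definition switched (k : nat) (j : 'I_(2 * n + 1)) (v : V) : V :=
  if v.1./2 != k then horizontal v
  else if v.2 == j then (v.1, ordS j)
  else if v.2 == ordS j then (v.1, j)
  else horizontal v.

Lemma horizontalK : involutive horizontal.
Proof. by case=> i j; rewrite /horizontal /= flipK. Qed.

Lemma adj_horizontal v : adj v (horizontal v).
Proof. by apply/torus_adjP; rewrite /= val_flip; case: ifP => ov; lia. Qed.

Lemma ordS_neq (j : 'I_(2 * n + 1)) : ordS j != j.
Proof.
have ltj := ltn_ord j; apply/eqP=> /(congr1 val) /=.
have [->|?] := eqVneq (j : nat) (2 * n); first by rewrite addn1 modnn => *; lia.
by rewrite modn_small => *; lia.
Qed.

Lemma switchedK k j : involutive (switched k j).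
Proof.
case=> i l; rewrite /switched /=; case: (eqVneq i./2 k) => [Di|Di] /=; last first.
  by rewrite flip_half Di horizontalK.
case: (eqVneq l j) => [->|lj] /=; first by rewrite Di eqxx (negbTE (ordS_neq j)) eqxx.
case: (eqVneq l (ordS j)) => [->|lSj] /=; first by rewrite Di !eqxx.
by rewrite flip_half Di eqxx /= (negbTE lj) (negbTE lSj) horizontalK.
Qed.

Lemma adj_switched k j v : adj v (switched k j v).
Proof.
case: v => i l; rewrite /switched /=; case: ifP => _; first exact: adj_horizontal.
case: eqP => [->|_]; first by rewrite /torus_adj /succ_mod /= !eqxx orbT.
case: eqP => [->|_]; last exact: adj_horizontal.
by rewrite /torus_adj /succ_mod /= !eqxx !orbT.
Qed.

Fact corner_subproof (k : 'I_m) : 2 * k < 2 * m.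
Proof. by have := ltn_ord k; lia. Qed.

Definition corner (k : 'I_m) (j : 'I_(2 * n + 1)) : V :=
  (Ordinal (corner_subproof k), j).

Definition rung k j : {set V} := [set corner k j; horizontal (corner k j)].

Lemma rungE (v : V) (k : 'I_m) j :
  v.1./2 = k -> v.2 = j -> [set v; horizontal v] = rung k j.
Proof.
move=> Dk Dj; apply: (matching_ofP horizontalK); first by apply/imsetP; exists v.
rewrite !inE; case: (boolP (odd v.1)) => ov; apply/orP; [right | left];
  rewrite -pair_eqE /= Dj eqxx andbT -val_eqE /= ?val_flip;
  by have := odd_double_half v.1; rewrite Dk ?ov ?(negbTE ov) => <-; rewrite mul2n.
Qed.

Lemma rung_inj k j k' j' : rung k j = rung k' j' -> (k, j) = (k', j').
Proof.
move/setP/(_ (corner k j)); rewrite !inE eqxx -!pair_eqE /= -!val_eqE /= val_flip /= oddM /=.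
move/esym=> H; congr (_, _); apply: val_inj => /=; lia.
Qed.

(* Otherwise the alternating square on the two rungs could be switched. *)
Lemma forcing_set_rung S k j :
  forcing_set adj (matching_of horizontal) S ->
  (rung k j \in S) || (rung k (ordS j) \in S).
Proof.
case/andP=> /subsetP sSM /forallP uniqM.
apply/negPn/negP; rewrite negb_or => /andP[nj nSj].
have sSM' : S \subset matching_of (switched k j).
  apply/subsetP=> e eS; have /imsetP[v _ De] := sSM e eS.
  apply/imsetP; exists v => //; rewrite De; congr [set _; _].
  rewrite /switched; case: eqP => //= Dk.
  case: eqP => [Dj|_]; first by rewrite -(rungE Dk Dj) -De eS in nj.
  by case: eqP => [Dj|//]; rewrite -(rungE Dk Dj) -De eS in nSj.
have := uniqM (matching_of (switched k j)); rewrite sSM' andbT.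
rewrite perfect_matching_of; [|exact: switchedK|exact: adj_switched].
move/eqP=> EM.
have rM : rung k j \in matching_of (switched k j).
  by rewrite EM; apply/imsetP; exists (corner k j).
have := set2_injr _ (matching_ofP (@switchedK k j) rM (set21 _ _)).
have -> : switched k j (corner k j) = (Ordinal (corner_subproof k), ordS j).
  by rewrite /switched /= [in (2 * k)./2]mul2n doubleK !eqxx.
have neq : flip (Ordinal (corner_subproof k)) != Ordinal (corner_subproof k).
  by rewrite -val_eqE /= val_flip /= oddM /=; lia.
rewrite /horizontal -pair_eqE /= negb_and neq => /(_ isT) [E _].
by rewrite E eqxx in neq.
Qed.

Lemma forcing_number_horizontal_geq :
  (n + 1) * m <= forcing_number adj (matching_of horizontal).
Proof.
apply: forcing_number_geq => [||S fS]; first exact: torus_adj_irr.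
  exact: perfect_matching_of horizontalK adj_horizontal.
pose A := [set p : 'I_m * 'I_(2 * n + 1) | rung p.1 p.2 \in S].
have leAS : #|A| <= #|S|.
  rewrite -(card_imset A (f := fun p => rung p.1 p.2)).
    by apply/subset_leq_card/subsetP=> _ /imsetP[p Ap ->]; rewrite inE in Ap.
  by move=> [k j] [k' j'] /rung_inj.
apply: leq_trans leAS.
have -> : #|A| = \sum_(k < m) \sum_(j < 2 * n + 1) (rung k j \in S).
  rewrite pair_bigA /= -sum1_card big_mkcond /=.
  by apply: eq_bigr => p _; rewrite inE; case: (_ \in S).
have -> : (n + 1) * m = \sum_(k < m) (n + 1).
  by rewrite sum_nat_const card_ord mulnC.
apply: leq_sum => k _.
have -> : \sum_(j < 2 * n + 1) (rung k j \in S) = #|[set j | rung k j \in S]|.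
  rewrite -sum1_card [in RHS]big_mkcond /=.
  by apply: eq_bigr => j _; rewrite inE; case: (_ \in S).
by apply: vertex_cover_odd_cycle => j; rewrite !inE forcing_set_rung.
Qed.

End Torus.

Theorem theorem5p2 (n m : nat) (hn : 1 <= n) (hm : 2 <= m) :
  max_forcing_number (@torus_adj n m) = (n + 1) * m.
Proof.
apply/eqP; rewrite eqn_leq; apply/andP; split.
  by apply/bigmax_leqP => M pM; apply: forcing_number_torus_leq.
apply: leq_trans (forcing_number_horizontal_geq hn hm) _.
apply: leq_bigmax_cond.
by apply: perfect_matching_of; [exact: horizontalK | exact: adj_horizontal].
Qed.
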